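(* Let $S$ be a simple, weakly cancellative $\mathrm{Cu}$-semigroup satisfying (O5) and (O6). Then \[ \dim(S_{\mathrm{soft}})\leq\dim(S)\leq\dim(S_{\mathrm{soft}})+1. \]
   Context: Way-below relation: in a partially ordered set, $x\ll y$ means that for every increasing sequence $(z_n)_n$ that has a supremum $z$ with $y\leq z$ there exists $n$ with $x\leq z_n$. A $\mathrm{Cu}$-semigroup is an abelian monoid $S$ with a partial order such that $0\leq x$ for all $x$, and $x\leq y$ implies $x+z\leq y+z$, satisfying: (O1) every increasing sequence has a supremum; (O2) every element is the supremum of a $\ll$-increasing sequence (i.e. $x_n\ll x_{n+1}$ for all $n$); (O3) $x'\ll x$ and $y'\ll y$ imply $x'+y'\ll x+y$; (O4) $\sup_n x_n+\sup_n y_n=\sup_n(x_n+y_n)$ for increasing sequences $(x_n)_n,(y_n)_n$. A $\mathrm{Cu}$-morphism is an order-preserving monoid morphism between $\mathrm{Cu}$-semigroups that preserves suprema of increasing sequences and the way-below relation. A submonoid $T\subseteq S$ is a sub-$\mathrm{Cu}$-semigroup if $T$ is a $\mathrm{Cu}$-semigroup with respect to the order induced by $S$ and the inclusion map $T\to S$ is a $\mathrm{Cu}$-morphism. (O5): given $x+y\leq z$, $x'\ll x$ and $y'\ll y$, there exists $c$ such that $x'+c\leq z\leq x+c$ and $y'\ll c$. (O6): given $x'\ll x\leq y+z$ there exist $v\leq x,y$ and $w\leq x,z$ (i.e. $v\leq x$, $v\leq y$, $w\leq x$, $w\leq z$) such that $x'\leq v+w$. Weakly cancellative: $x+z\ll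 y+z$ implies $x\ll y$. Simple: for all $x,y\in S$ with $y\neq0$ we have $x\leq\infty y$, where $\infty y:=\sup_n ny$. Soft elements: $x\in S$ is soft if for every $x'\in S$ with $x'\ll x$ there exists $k\in\mathbb{N}$ such that $(k+1)x'\ll kx$. The set of soft elements is denoted $S_{\mathrm{soft}}$; for $S$ simple, weakly cancellative and satisfying (O5) and (O6), it is known that $S_{\mathrm{soft}}$ is a sub-$\mathrm{Cu}$-semigroup of $S$ satisfying (O5) and (O6) (Antoine-Perera-Thiel), so $\dim(S_{\mathrm{soft}})$ is defined. Dimension (with $\mathbb{N}=\{0,1,2,\ldots\}$): for a $\mathrm{Cu}$-semigroup $S$ and $n\in\mathbb{N}$, write $\dim(S)\leq n$ if, whenever $x'\ll x\ll y_1+\ldots+y_r$ in $S$, there exist $z_{j,k}\in S$ for $j=1,\ldots,r$ and $k=0,\ldots,n$ such that (i) $z_{j,k}\ll y_j$ for all $j,k$; (ii) $x'\ll\sum_{j,k}z_{j,k}$; (iii) $\sum_{j=1}^r z_{j,k}\ll x$ for each $k=0,\ldots,n$. Then $\dim(S)$ is the smallest such $n$, and $\dim(S)=\infty$ if no such $n$ exists. *)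

(* Defs.v *)
From HB Require Import structures.
From mathcomp Require Import all_boot all_order all_algebra.
From mathcomp Require Import mathcomp_extra boolp classical_sets constructive_ereal.

Set Implicit Arguments.
Unset Strict Implicit.
Unset Printing Implicit Defensive.

Import GRing.Theory.

Local Open Scope ring_scope.

Declare Scope pom_scope.
Delimit Scope pom_scope with pom.

(* Positively ordered monoids. The order is not an instance of Order.POrder:  *)
(* ssrnum already joins Nmodule and POrder in Num.POrderedZmodule, and        *)
(* Hierarchy Builder then rejects any weaker join of the two structures.      *)
HB.mixin Record Nmodule_isPoM S of GRing.Nmodule S := {
  pom_le : S -> S -> Prop;
  pom_lexx : forall x : S, pom_le x x;
  pom_le_anti : forall x y : S, pom_le x y -> pom_le y x -> x = y;
  pom_le_trans : forall y x z : S, pom_le x y -> pom_le y z -> pom_le x z;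
  pom_ge0 : forall x : S, pom_le 0 x;
  pom_leD2r : forall z x y : S, pom_le x y -> pom_le (x + z) (y + z)
}.

#[short(type="pomType")]
HB.structure Definition PoM := { S of GRing.Nmodule S & Nmodule_isPoM S }.

Arguments pom_le_anti {s} [x y].
Arguments pom_le_trans {s} [y x z].
Arguments pom_leD2r {s} z [x y].

Notation "x <= y" := (pom_le x y) : pom_scope.
Local Open Scope pom_scope.

Section WayBelow.
Variable S : pomType.
Implicit Types (x y : S) (z : nat -> S).

Definition increasing z := forall n, z n <= z n.+1.

Definition is_sup z s :=
  (forall n, z n <= s) /\ (forall u, (forall n, z n <= u) -> s <= u).

Definition way_below x y :=
  forall z s, increasing z -> is_sup z s -> y <= s -> exists n, x <= z n.

End WayBelow.

Notation "x ≪ y" := (way_below x y) (at level 70, no associativity) : pom_scope.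

HB.mixin Record PoM_isCuSemigroup S of PoM S := {
  cu_O1 : forall z : nat -> S, increasing z -> exists s, is_sup z s;
  cu_O2 : forall x : S, exists z : nat -> S,
    (forall n, z n ≪ z n.+1) /\ is_sup z x;
  cu_O3 : forall x' x y' y : S, x' ≪ x -> y' ≪ y -> x' + y' ≪ x + y;
  cu_O4 : forall (u v : nat -> S) (x y : S), increasing u -> increasing v ->
    is_sup u x -> is_sup v y -> is_sup (fun n => u n + v n) (x + y)
}.

#[short(type="cuType")]
HB.structure Definition CuSemigroup := { S of PoM S & PoM_isCuSemigroup S }.

Arguments cu_O1 {s} [z] _.
Arguments cu_O2 {s} x.
Arguments cu_O3 {s} [x' x y' y] _ _.
Arguments cu_O4 {s} [u v x y] _ _ _ _.

Section Properties.
Variable S : cuType.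
Implicit Types x y z : S.

Definition O5 := forall x y z x' y',
  x + y <= z -> x' ≪ x -> y' ≪ y ->
  exists c, [/\ x' + c <= z, z <= x + c & y' ≪ c].

Definition O6 := forall x' x y z,
  x' ≪ x -> x <= y + z ->
  exists v w, [/\ v <= x, v <= y, w <= x, w <= z & x' <= v + w].

Definition weakly_cancellative := forall x y z, x + z ≪ y + z -> x ≪ y.

(* The default value 0 is irrelevant: n |-> y *+ n is increasing, so it has a *)
(* (unique) supremum by (O1).                                                 *)
Definition infty y : S := xget 0 [set s | is_sup (fun n => y *+ n) s]%classic.

Definition cu_simple := forall x y, y <> 0 -> x <= infty y.

Definition soft x := forall x', x' ≪ x -> exists k, x' *+ k.+1 ≪ x *+ k.

Definition soft_pred : {pred S} := fun x => `[< soft x >].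

End Properties.

Section WayBelowTheory.
Variable S : pomType.
Implicit Types x y : S.

Lemma way_below_le x y : x ≪ y -> x <= y.
Proof.
move=> /(_ (fun=> y) y)[n|||n //]; try exact: pom_lexx.
by split=> [n|u]; [exact: pom_lexx|apply; exact: 0%N].
Qed.

Lemma way_below_le_trans y x z : x ≪ y -> y <= z -> x ≪ z.
Proof. by move=> xy yz u s u_inc us /(pom_le_trans yz); apply: xy. Qed.

Lemma le_way_below_trans y x z : x <= y -> y ≪ z -> x ≪ z.
Proof.
move=> xy yz u s u_inc us zs; have [n yu] := yz u s u_inc us zs.
by exists n; apply: pom_le_trans yu.
Qed.

Lemma way_below0 x : 0 ≪ x.
Proof. by move=> u s _ _ _; exists 0%N; apply: pom_ge0. Qed.

Lemma pom_leD x x' y y' : x <= x' -> y <= y' -> x + y <= x' + y'.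
Proof.
move=> xx' yy'; apply: pom_le_trans (pom_leD2r _ xx') _.
by rewrite ![x' + _]addrC; apply: pom_leD2r.
Qed.

Lemma pom_leMn n x y : x <= y -> x *+ n <= y *+ n.
Proof.
move=> xy; elim: n => [|n IHn]; first exact: pom_lexx.
by rewrite !mulrS; apply: pom_leD.
Qed.

End WayBelowTheory.

Section SoftClosed.
Variable S : cuType.
Implicit Types x y z : S.

Lemma way_belowMn n x y : x ≪ y -> x *+ n ≪ y *+ n.
Proof.
move=> xy; elim: n => [|n IHn]; first exact: way_below0.
by rewrite !mulrS; apply: cu_O3.
Qed.

Lemma soft_widen x x' k m : x' ≪ x -> (k <= m)%N ->
  x' *+ k.+1 ≪ x *+ k -> x' *+ m.+1 ≪ x *+ m.
Proof.
move=> x'x km xk; rewrite -(subnK km) -addnS !mulrnDr.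
by apply: cu_O3 => //; apply: way_belowMn.
Qed.

Lemma soft_pred_addr_closed : addr_closed (@soft_pred S).
Proof.
split=> [|x y /asboolP x_soft /asboolP y_soft]; apply/asboolP.
  move=> x' /way_below_le x'0; exists 0%N.
  exact: (le_way_below_trans x'0 (@way_below0 S _)).
move=> t t_xy.
have [u [u_wb u_sup]] := cu_O2 x; have [v [v_wb v_sup]] := cu_O2 y.
have u_inc : increasing u by move=> n; apply: way_below_le.
have v_inc : increasing v by move=> n; apply: way_below_le.
have ux n : u n ≪ x by apply: way_below_le_trans (u_wb n) (u_sup.1 n.+1).
have vy n : v n ≪ y by apply: way_below_le_trans (v_wb n) (v_sup.1 n.+1).
have [|n t_uv] :=
  t_xy _ _ _ (cu_O4 u_inc v_inc u_sup v_sup) (pom_lexx _).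
  by move=> n; apply: pom_leD.
have [k xk] := x_soft _ (ux n); have [l yl] := y_soft _ (vy n).
exists (maxn k l).
apply: (le_way_below_trans (pom_leMn _ t_uv)); rewrite !mulrnDl; apply: cu_O3.
- exact: soft_widen (ux n) (leq_maxl _ _) xk.
- exact: soft_widen (vy n) (leq_maxr _ _) yl.
Qed.

End SoftClosed.

(* S_soft, with the addition and the order induced by S.                      *)
Record softType (S : cuType) :=
  SoftType { soft_val :> S; _ : soft_pred soft_val }.

HB.instance Definition _ (S : cuType) := [isSub for @soft_val S].
HB.instance Definition _ (S : cuType) := [Choice of softType S by <:].
HB.instance Definition _ (S : cuType) :=
  GRing.SubChoice_isSubNmodule.Build S (@soft_pred S) (softType S)
    (@soft_pred_addr_closed S).

Section SoftPoM.
Variable S : cuType.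
Implicit Types x y z : softType S.

Definition soft_le x y := (val x : S) <= val y.

Fact soft_lexx x : soft_le x x.
Proof. exact: pom_lexx. Qed.

Fact soft_le_anti x y : soft_le x y -> soft_le y x -> x = y.
Proof. by move=> xy yx; apply/val_inj/pom_le_anti. Qed.

Fact soft_le_trans y x z : soft_le x y -> soft_le y z -> soft_le x z.
Proof. exact: pom_le_trans. Qed.

Fact soft_ge0 x : soft_le 0 x.
Proof. exact: pom_ge0. Qed.

Fact soft_leD2r z x y : soft_le x y -> soft_le (x + z) (y + z).
Proof. exact: pom_leD2r. Qed.

HB.instance Definition _ := Nmodule_isPoM.Build (softType S)
  soft_lexx soft_le_anti soft_le_trans soft_ge0 soft_leD2r.

End SoftPoM.

(* The dimension only refers to the positively ordered monoid structure; for  *)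
(* S_soft, way-below is thus computed inside S_soft.                          *)
Section Dimension.
Variable S : pomType.

Definition cu_dim_le (n : nat) :=
  forall (x' x : S) (r : nat) (y : 'I_r -> S),
  x' ≪ x -> x ≪ \sum_(j < r) y j ->
  exists z : 'I_r -> 'I_n.+1 -> S,
    [/\ forall j k, z j k ≪ y j,
        x' ≪ \sum_(j < r) \sum_(k < n.+1) z j k
      & forall k, \sum_(j < r) z j k ≪ x].

(* The values are natural numbers or +oo; they live in \bar int because the   *)
(* order on \bar R requires R to be a numDomainType.                          *)
Definition cu_dim : \bar int :=
  if pselect (exists n, `[< cu_dim_le n >]) is left ex then (ex_minn ex)%:Z%:E
  else +oo%E.

End Dimension.

(* Main.v *)
Require Import Defs.
From mathcomp Require Import all_boot all_order all_algebra.
From mathcomp Require Import constructive_ereal.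
From mathcomp Require Import boolp classical_sets.

(** A nonzero element x is soft exactly when it leaves room above everything
    way below it: whenever x' ≪ x, there is c <> 0 with x' + c <= x
    (has_room_soft, soft_has_room). Room is inherited by x + s from s, whatever
    x is (has_roomDr), so adding a nonzero soft element makes any element soft.
    The two inequalities follow once there are arbitrarily small soft elements
    to add.

    Either every nonzero a dominates some b *+ 2 with b <> 0, or there is a
    minimal nonzero element, an atom (atom_or_halvable).

    In the first case, iterated halving yields a soft element below any nonzero
    one (has_room_below), and finitely many smallness conditions can be imposed
    simultaneously since any two nonzero elements have a nonzero common lower
    bound (common_below). In particular soft elements can be approximated by
    soft elements way below them, so that the way-below relation of S_soft is
    the restriction of that of S.
    - dim S_soft <= dim S: for x and the y_j soft, take the z_jk given by the
      dimension of S and add one small soft w to each of them. Room in x and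
      in the y_j keeps the required upper bounds (soft_cu_dim_le).
    - dim S <= dim S_soft + 1: write x approximately as u + c with u nonzero,
      below x and below some y_j0, and c soft. Replace the y_j by soft
      elements s_j that are smaller by so little that the total error fits
      into u. Weak cancellation gives c ≪ \sum_j s_j, the dimension of S_soft
      decomposes c, and the additional colour is used for u (cu_dim_le_soft).

    In the second case S consists of the multiples of the atom and of suprema
    of these, and S_soft has at most one nonzero element. This element is way
    below itself in S_soft although not in S, hence the separate treatment: both
    semigroups satisfy the covering condition for every n, by splitting
    multiples of the atom (atomic_cu_dim_le, atomic_soft_cu_dim_le). *)

Set Implicit Arguments.
Unset Strict Implicit.
Unset Printing Implicit Defensive.

Import GRing.Theory.

Local Open Scope ring_scope.
Local Open Scope pom_scope.

(** * Order and way-below relation *)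

Section PoMTheory.
Variable S : pomType.
Implicit Types x y z : S.

Lemma pom_le0 x : x <= 0 -> x = 0.
Proof. by move=> x0; apply: pom_le_anti x0 (pom_ge0 _). Qed.

Lemma pom_leDl x y : x <= x + y.
Proof. by rewrite -{1}[x]addr0; apply: pom_leD (pom_lexx _) (pom_ge0 _). Qed.

Lemma pom_leDr x y : x <= y + x.
Proof. by rewrite addrC; apply: pom_leDl. Qed.

Lemma pom_leMnr x m n : (m <= n)%N -> x *+ m <= x *+ n.
Proof. by move=> /subnK <-; rewrite mulrnDr; apply: pom_leDr. Qed.

Lemma pom_le_sum (I : finType) (u v : I -> S) :
  (forall i, u i <= v i) -> \sum_i u i <= \sum_i v i.
Proof.
move=> uv; apply: (big_ind2 (fun s t : S => s <= t)) => //.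
- exact: pom_lexx.
- by move=> *; apply: pom_leD.
Qed.

Lemma increasing_le (z : nat -> S) m n : increasing z -> (m <= n)%N -> z m <= z n.
Proof.
move=> z_inc /subnK <-; elim: (n - m)%N => [|k IHk]; first exact: pom_lexx.
exact: pom_le_trans IHk (z_inc _).
Qed.

Lemma sum_neq0 (I : finType) (u : I -> S) : \sum_i u i <> 0 -> exists i, u i <> 0.
Proof.
move=> u_neq0; apply: contrapT => /forallNP u0; apply: u_neq0.
by apply: big1 => i _; apply: contrapT.
Qed.

End PoMTheory.

Section CuTheory.
Variable S : cuType.
Implicit Types x y z : S.

Lemma way_below_seq x :
  exists u : nat -> S, [/\ increasing u, forall n, u n ≪ x & is_sup u x].
Proof.
have [u [u_wb u_sup]] := cu_O2 x; exists u; split=> // n.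
  exact: way_below_le.
exact: way_below_le_trans (u_wb n) (u_sup.1 n.+1).
Qed.

Lemma way_below_interpolate x z : x ≪ z -> exists2 y, x ≪ y & y ≪ z.
Proof.
move=> xz; have [u [u_wb u_sup]] := cu_O2 z.
have [|n xu] := xz u z _ u_sup (pom_lexx _); first by move=> n; apply: way_below_le.
exists (u n.+1); first exact: le_way_below_trans xu (u_wb n).
exact: way_below_le_trans (u_wb _) (u_sup.1 _).
Qed.

Lemma le_way_belowP x y : (forall x', x' ≪ x -> x' <= y) -> x <= y.
Proof.
move=> xy; have [u [_ ux [_ u_sup]]] := way_below_seq x.
by apply: u_sup => n; apply: xy.
Qed.

Lemma neq0_way_below x : x <> 0 -> exists2 x', x' <> 0 & x' ≪ x.
Proof.
move=> x_neq0; apply: contrapT => no_x'; apply/x_neq0/pom_le0/le_way_belowP => x' x'x.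
suff -> : x' = 0 by apply: pom_lexx.
by apply: contrapT => x'_neq0; apply: no_x'; exists x'.
Qed.

Lemma way_belowD t x y : t ≪ x + y -> exists x' y', [/\ x' ≪ x, y' ≪ y & t ≪ x' + y'].
Proof.
move=> /way_below_interpolate[t' tt' t'xy].
have [u [u_inc ux u_sup]] := way_below_seq x.
have [v [v_inc vy v_sup]] := way_below_seq y.
have [|n t'uv] := t'xy _ _ _ (cu_O4 u_inc v_inc u_sup v_sup) (pom_lexx _).
  by move=> n; apply: pom_leD.
by exists (u n), (v n); split=> //; apply: way_below_le_trans t'uv.
Qed.

Lemma way_below_infty x x' y : x' ≪ x -> x <= infty y -> exists n, x' <= y *+ n.
Proof.
have y_inc : increasing (fun n => y *+ n) by move=> n; apply: pom_leMnr.
have y_sup : is_sup (fun n => y *+ n) (infty y).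
  by rewrite /infty; case: xgetP => // no_sup; have [s /no_sup] := cu_O1 y_inc.
by move=> x'x; apply: x'x.
Qed.

(** Weak cancellation only speaks about the way-below relation; on compact
    sums it cancels inequalities. *)
Lemma compact_cancel x y z :
  weakly_cancellative S -> x + z ≪ x + z -> x + z <= y + z -> x <= y.
Proof.
by move=> cancelS xz xyz; apply/way_below_le/(cancelS _ _ z)/(way_below_le_trans xz).
Qed.

(** The instance of (O5) with second summand 0: an almost complement. *)
Lemma O5_complement u' u x :
  O5 S -> u' ≪ u -> u <= x -> exists c, u' + c <= x /\ x <= u + c.
Proof.
move=> O5S u'u ux; have [|c [u'c xc _]] := O5S u 0 x u' 0 _ u'u (@way_below0 S 0).
  by rewrite addr0.
by exists c.
Qed.

End CuTheory.

(** * Soft elements leave room *)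

(** Such an x is nonzero, as x' = 0 shows. In the semigroups considered here,
    has_room characterizes the nonzero soft elements, and it is the form of
    softness that the arguments use. *)
Definition has_room (S : cuType) (x : S) :=
  forall x', x' ≪ x -> exists2 c, c <> 0 & x' + c <= x.

Section Room.
Variable S : cuType.
Implicit Types (c s t u w x y z : S).

Lemma has_room_neq0 x : has_room x -> x <> 0.
Proof.
move=> x_room x0; have [c c_neq0] := x_room 0 (@way_below0 S x).
by rewrite add0r x0 => /pom_le0.
Qed.

(** By simplicity a multiple c *+ k of the room c absorbs one more copy of y,
    and k copies of x contain k copies of y together with c *+ k. *)
Lemma has_room_soft x : cu_simple S -> has_room x -> soft x.
Proof.
move=> simpleS x_room x' /way_below_interpolate[y x'y yx].
have [c c_neq0 ycx] := x_room _ yx.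
have [k yk] := way_below_infty yx (simpleS _ _ c_neq0).
exists k; apply: way_below_le_trans (way_belowMn x'y) _.
rewrite mulrSr; apply: pom_le_trans (pom_leMn k ycx).
by rewrite mulrnDl; apply: pom_leD (pom_lexx _) yk.
Qed.

(** Here x *+ k.+1 ≪ x *+ k, and weak cancellation leaves x ≪ 0. *)
Lemma soft_compact_eq0 x : weakly_cancellative S -> soft x -> x ≪ x -> x = 0.
Proof.
move=> cancelS x_soft xx; have [k] := x_soft x xx.
rewrite mulrS -[X in _ ≪ X]add0r => /cancelS/way_below_le.
exact: pom_le0.
Qed.

(** The almost complement c of x' in x vanishes only if x is compact, which
    soft_compact_eq0 excludes. *)
Lemma soft_has_room x :
  weakly_cancellative S -> O5 S -> soft x -> x <> 0 -> has_room x.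
Proof.
move=> cancelS O5S x_soft x_neq0 x' /way_below_interpolate[y x'y yx].
have [c [x'c xc]] := O5_complement O5S x'y (way_below_le yx).
exists c => // c0; apply: x_neq0; apply: soft_compact_eq0 => //.
by apply: le_way_below_trans yx; rewrite -[y]addr0 -c0.
Qed.

(** Hence x + s is soft and nonzero for every x, compact or not. *)
Lemma has_roomDr x s : has_room s -> has_room (x + s).
Proof.
move=> s_room t /way_belowD[x' [s' [x'x s's ts]]].
have [c c_neq0 s'c] := s_room _ s's; exists c => //.
apply: pom_le_trans (pom_leD2r _ (way_below_le ts)) _.
by rewrite -addrA; apply: pom_leD => //; apply: way_below_le.
Qed.

(** Suprema taken in S_soft thus agree with those taken in S. *)
Lemma soft_sup (u : nat -> S) x :
  increasing u -> is_sup u x -> (forall n, soft (u n)) -> soft x.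
Proof.
move=> u_inc u_sup u_soft x' /way_below_interpolate[y x'y yx].
have [n yu] := yx u x u_inc u_sup (pom_lexx _).
have [k xk] := u_soft n x' (way_below_le_trans x'y yu).
by exists k; apply: way_below_le_trans xk (pom_leMn _ (u_sup.1 n)).
Qed.

End Room.

(** * Small elements *)

(** P holds for all sufficiently small elements. By common_below, finitely many
    such conditions can be met by a single element. *)
Definition near0 (S : cuType) (P : S -> Prop) :=
  exists2 d, d <> 0 & forall w, w <= d -> P w.

Definition halvable (S : cuType) :=
  forall a : S, a <> 0 -> exists2 b, b <> 0 & b *+ 2 <= a.

Definition atom (S : cuType) (a : S) :=
  a <> 0 /\ forall b, b <> 0 -> b <= a -> b = a.

Section Small.
Variable S : cuType.
Hypotheses (simpleS : cu_simple S) (O5S : O5 S) (O6S : O6 S).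
Implicit Types (a b c d w x y z : S) (P : S -> Prop).

(** By simplicity a nonzero a' ≪ a lies below a multiple of b. (O6) splits off
    one summand b at a time, until the part v below b is nonzero; the part w
    below the remaining summands is nonzero otherwise. *)
Lemma common_below a b :
  a <> 0 -> b <> 0 -> exists c, [/\ c <> 0, c <= a & c <= b].
Proof.
move=> a_neq0 b_neq0; have [a' a'_neq0 a'a] := neq0_way_below a_neq0.
have [n a'n] := way_below_infty a'a (simpleS a b_neq0).
suff [c [c_neq0 ca' cb]] : exists c, [/\ c <> 0, c <= a' & c <= b].
  by exists c; split=> //; apply: pom_le_trans ca' (way_below_le a'a).
elim: n => [|n IHn] in a' a'_neq0 {a'a} a'n *; first by move/pom_le0: a'n.
have [a'' a''_neq0 a''a'] := neq0_way_below a'_neq0.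
rewrite mulrS in a'n; have [v [w [va' vb wa' wb a''vw]]] := O6S a''a' a'n.
have [v0|v_neq0] := pselect (v = 0); last by exists v.
have w_neq0 : w <> 0.
  by move=> w0; apply/a''_neq0/pom_le0; rewrite -[0]addr0 -{1}v0 -w0.
have [c [c_neq0 cw cb]] := IHn w w_neq0 wb.
by exists c; split=> //; apply: pom_le_trans wa'.
Qed.

Lemma near0_and P Q : near0 P -> near0 Q -> near0 (fun w => P w /\ Q w).
Proof.
move=> [d d_neq0 dP] [e e_neq0 eQ].
have [c [c_neq0 cd ce]] := common_below d_neq0 e_neq0; exists c => // w wc.
by split; [apply: dP|apply: eQ]; apply: pom_le_trans wc _.
Qed.

Lemma near0_forall (I : finType) (P : I -> S -> Prop) :
  (exists x : S, x <> 0) ->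
  (forall i, near0 (P i)) -> near0 (fun w => forall i, P i w).
Proof.
move=> [x x_neq0] nearP.
suff [d d_neq0 dP] : near0 (fun w => forall i, i \in enum I -> P i w).
  by exists d => // w /dP Pw i; apply: Pw; rewrite mem_enum.
elim: (enum I) => [|i s IHs]; first by exists x.
have [d d_neq0 dP] := near0_and (nearP i) IHs; exists d => // w /dP[Piw Psw] j.
by rewrite inE => /predU1P[->|/Psw].
Qed.

(** If b <= a are nonzero and b' ≪ b'' ≪ b with b' <> 0, let c be an almost
    complement of b' in a. If c <> 0, then a common lower bound of b' and c
    halves a; if c = 0, then a <= b'' <= b. So a nonzero element that cannot be
    halved is minimal. *)
Lemma atom_or_halvable : (exists a : S, atom a) \/ halvable S.
Proof.
have [|no_atom] := pselect (exists a : S, atom a); [by left|right=> a a_neq0].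
apply: contrapT => no_half; apply: no_atom; exists a; split=> // b b_neq0 ba.
have [b'' b''_neq0 b''b] := neq0_way_below b_neq0.
have [b' b'_neq0 b'b''] := neq0_way_below b''_neq0.
have b''a := pom_le_trans (way_below_le b''b) ba.
have [c [b'c ac]] := O5_complement O5S b'b'' b''a.
have [c0|c_neq0] := pselect (c = 0).
  apply: pom_le_anti ba (pom_le_trans ac _).
  by rewrite c0 addr0; apply: way_below_le.
have [d [d_neq0 db' dc]] := common_below b'_neq0 c_neq0.
case: no_half; exists d => //; rewrite mulr2n.
exact: pom_le_trans (pom_leD db' dc) b'c.
Qed.

Hypothesis halvS : halvable S.

Lemma near0_mulrn P n : near0 P -> near0 (fun w => P (w *+ n)).
Proof.
move=> [d d_neq0 dP].
(* Iterated halving reaches only powers of 2. *)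
suff [e e_neq0 ed] : exists2 e, e <> 0 & e *+ 2 ^ n <= d.
  exists e => // w we; apply: dP; apply: pom_le_trans (pom_leMn n we) _.
  by apply: pom_le_trans ed; apply/pom_leMnr/ltnW/ltn_expl.
elim: n => [|n [e e_neq0 ed]]; first by exists d => //; rewrite mulr1n; apply: pom_lexx.
have [b b_neq0 be] := halvS e_neq0; exists b => //.
by rewrite expnS mulrnA; apply: pom_le_trans (pom_leMn _ be) ed.
Qed.

(** If a_n is obtained from c by n halvings, then the sum of the a_n for n >= 1
    is soft: the tail after any partial sum dominates the nonzero next term. *)
Lemma has_room_below c : c <> 0 -> exists2 w, has_room w & w <= c.
Proof.
move=> c_neq0.
have /choice[h hP] (a : S) : exists b, a <> 0 -> b <> 0 /\ b *+ 2 <= a.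
  have [a0|/halvS[b b_neq0 ba]] := pselect (a = 0); first by exists 0.
  by exists b.
pose a n := iter n h c; have a_neq0 n : a n <> 0.
  by elim: n => //= n IHn; apply: (hP _ IHn).1.
pose u n := \sum_(i < n) a i.+1.
have uS n : u n.+1 = u n + a n.+1 by rewrite /u big_ord_recr.
have u_inc : increasing u by move=> n; rewrite uS; apply: pom_leDl.
(* The summand a n makes the bound on the partial sums inductive. *)
have uc n : u n + a n <= c.
  elim: n => [|n IHn]; first by rewrite /u big_ord0 add0r; apply: pom_lexx.
  apply: pom_le_trans IHn; rewrite uS -addrA; apply: pom_leD (pom_lexx _) _.
  by rewrite -mulr2n; apply: (hP _ (a_neq0 n)).2.
have [w [uw w_le]] := cu_O1 u_inc.
exists w; last by apply: w_le => n; apply: pom_le_trans (pom_leDl _ _) (uc n).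
move=> w' w'w; have [n w'u] := w'w u w u_inc (conj uw w_le) (pom_lexx _).
exists (a n.+1) => //; apply: pom_le_trans (pom_leD2r _ w'u) _.
by rewrite -uS.
Qed.

Lemma near0_has_room P : near0 P -> exists2 w, has_room w & P w.
Proof.
by move=> [d /has_room_below[w w_room wd] dP]; exists w => //; apply: dP.
Qed.

Lemma has_room_near0 z x : has_room x -> z ≪ x -> near0 (fun w => z + w ≪ x).
Proof.
move=> x_room /way_below_interpolate[y zy yx].
have [c c_neq0 ycx] := x_room _ yx.
have [d d_neq0 dc] := neq0_way_below c_neq0; exists d => // w wd.
by apply: way_below_le_trans ycx; apply: cu_O3 => //; apply: le_way_below_trans dc.
Qed.

Lemma has_room_interpolate z x :
  has_room x -> z ≪ x -> exists s, [/\ has_room s, z <= s & s ≪ x].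
Proof.
move=> x_room zx; have [w w_room zwx] := near0_has_room (has_room_near0 x_room zx).
by exists (z + w); split=> //; [apply: has_roomDr|apply: pom_leDl].
Qed.

(** Remove from y some nonzero u below e and put back a soft v smaller than u:
    what remains of y plus v is soft by has_roomDr. *)
Lemma soft_approx y e : e <> 0 -> exists s, [/\ soft s, s <= y & y <= s + e].
Proof.
move=> e_neq0; have [->|y_neq0] := pselect (y = 0).
  exists 0; split; [|exact: pom_lexx|exact: pom_ge0].
  exact/asboolP/(soft_pred_addr_closed S).1.
have [u [u_neq0 ue uy]] := common_below e_neq0 y_neq0.
have [u' u'_neq0 u'u] := neq0_way_below u_neq0.
have [c [u'c yc]] := O5_complement O5S u'u uy.
have [v v_room vu'] := has_room_below u'_neq0.
exists (c + v); split; first exact/has_room_soft/has_roomDr.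
- by apply: pom_le_trans u'c; rewrite addrC; apply: pom_leD2r.
- apply: pom_le_trans yc _; rewrite addrC; apply: pom_leD ue.
  exact: pom_leDl.
Qed.

End Small.

(** * The semigroup of soft elements *)

Section SoftSemigroup.
Variable S : cuType.
Implicit Types x y z : softType S.

Lemma softP x : soft (val x).
Proof. by apply/asboolP; case: x. Qed.

Definition to_soft (s : S) (s_soft : soft s) : softType S :=
  SoftType (asboolT s_soft).

Lemma val_soft_eq0 x : val x = 0 -> x = 0.
Proof. by move=> x0; apply: val_inj; rewrite x0 raddf0. Qed.

(** An increasing sequence has the same supremum in S and in S_soft, so there
    are no more sequences to test in S_soft than in S. *)
Lemma way_below_soft x y : val x ≪ val y -> x ≪ y.
Proof.
move=> xy u s u_inc [us s_le] ys.
have [t t_sup] := @cu_O1 S (val \o u) u_inc.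
have t_soft : soft t by apply: soft_sup u_inc t_sup _ => n; apply: softP.
apply: (xy (val \o u) t u_inc t_sup).
have st : s <= to_soft t_soft by apply: s_le => n; apply: t_sup.1.
exact: pom_le_trans ys st.
Qed.

Hypotheses (simpleS : cu_simple S) (cancelS : weakly_cancellative S).
Hypotheses (O5S : O5 S) (O6S : O6 S) (halvS : halvable S).

(** The supremum y has to be reached by a sequence inside S_soft whose terms are
    way below y in S. Halving provides it: soft elements interpolate, so a
    sequence u with supremum y can be interleaved with an increasing sequence q
    of soft elements, with u n <= q n.+1 ≪ y. *)
Lemma soft_way_below x y : x ≪ y -> val x ≪ val y.
Proof.
move=> xy; have [y0|y_neq0] := pselect (val y = 0).
  have : (val x : S) <= val y by apply: way_below_le xy.
  by rewrite y0 => /pom_le0 ->; apply: way_below0.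
have y_room := soft_has_room cancelS O5S (@softP y) y_neq0.
have [u [u_inc uy u_sup]] := way_below_seq (val y).
have /choice[g gP] (p : softType S * nat) : exists q : softType S,
    val p.1 ≪ val y -> [/\ p.1 <= q, u p.2 <= val q & val q ≪ val y].
  case: p => s n /=.
  have [sy|nsy] := pselect (val s ≪ val y); last by exists 0 => /nsy.
  have [m sm] := sy u _ u_inc u_sup (pom_lexx _).
  have [t [t_room ut ty]] :=
    has_room_interpolate halvS y_room (uy (maxn m n)).
  exists (to_soft (has_room_soft simpleS t_room)) => _; split=> //.
  - apply: pom_le_trans sm (pom_le_trans _ ut).
    exact: increasing_le u_inc (leq_maxl _ _).
  - exact: pom_le_trans (increasing_le u_inc (leq_maxr _ _)) ut.
pose q := fix q n := if n is k.+1 then g (q k, k) else 0.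
have qy n : val (q n) ≪ val y.
  elim: n => [|n IHn] /=; first exact: way_below0.
  by have [] := gP (q n, n) IHn.
have q_inc : increasing q by move=> n; have [] := gP (q n, n) (qy n).
have [|n xq] := xy q y q_inc _ (pom_lexx _); last first.
  exact: (le_way_below_trans (xq : (val x : S) <= val (q n)) (qy n)).
split=> [n|v qv]; first exact: way_below_le (qy n).
apply: u_sup.2 => n; have [_ uq _] := gP (q n, n) (qy n).
exact: pom_le_trans uq (qv n.+1).
Qed.

End SoftSemigroup.

(** * Semigroups with an atom *)

Section Atomic.
Variable S : cuType.
Hypotheses (simpleS : cu_simple S) (cancelS : weakly_cancellative S).
Hypotheses (O5S : O5 S) (O6S : O6 S).
Variable a : S.
Hypothesis a_atom : atom a.
Implicit Types x y z : S.

(** A nonzero common lower bound of a and x can only be a itself. *)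
Lemma atom_le x : x <> 0 -> a <= x.
Proof.
case: a_atom => a_neq0 a_min /(common_below simpleS O6S a_neq0)[c [c_neq0 ca cx]].
by rewrite -(a_min c).
Qed.

Lemma atom_compact n : a *+ n ≪ a *+ n.
Proof.
apply: way_belowMn; have [a' a'_neq0 a'a] := neq0_way_below a_atom.1.
exact: le_way_below_trans (atom_le a'_neq0) a'a.
Qed.

Lemma atom_subtract x : x <> 0 -> exists y, x = a + y.
Proof.
move=> /atom_le ax; have [y [ay xy]] := O5_complement O5S (@atom_compact 1) ax.
by exists y; apply: pom_le_anti.
Qed.

Lemma way_below_atom x' x : x' ≪ x -> exists n, x' <= a *+ n.
Proof. by move=> /way_below_infty; apply; apply/simpleS/a_atom.1. Qed.

(** Every element is a supremum of elements below multiples of the atom, so it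
    is a multiple of the atom or a supremum of such multiples. *)
Lemma le_atom_mulrn x n : x <= a *+ n -> exists k, x = a *+ k.
Proof.
elim: n x => [|n IHn] x xn; first by exists 0%N; apply: pom_le0.
have [->|/atom_subtract[y x_ay]] := pselect (x = 0); first by exists 0%N.
move: xn; rewrite mulrSr => xn.
have yn : y ≪ a *+ n.
  apply: (cancelS (z := a)); rewrite addrC -x_ay; apply: le_way_below_trans xn _.
  by rewrite -mulrSr; apply: atom_compact.
by have [k y_ak] := IHn y (way_below_le yn); exists k.+1; rewrite mulrS -y_ak.
Qed.

(** Riesz decomposition for multiples of the atom: some y i is nonzero, hence
    contains a; remove a from it and cancel a on both sides. *)
Lemma atom_sum (I : finType) k (y : I -> S) : a *+ k <= \sum_i y i ->
  exists f : I -> nat, (forall i, a *+ f i <= y i) /\ (\sum_i f i)%N = k.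
Proof.
elim: k y => [|k IHk] y kay.
  by exists (fun=> 0%N); split=> [i|]; [apply: pom_ge0|apply: big1].
have y_neq0 : \sum_i y i <> 0.
  move=> y0; apply: a_atom.1; apply: pom_le0; rewrite -y0.
  by apply: pom_le_trans kay; rewrite mulrS; apply: pom_leDl.
have [i0 /atom_subtract[c yi0]] := sum_neq0 y_neq0.
pose y' i := if i == i0 then c else y i.
have yE : \sum_i y i = \sum_i y' i + a.
  rewrite (bigD1 i0) //= [in RHS](bigD1 i0) //= yi0 /y' eqxx -addrA addrC.
  by congr (_ + _ + _); apply: eq_bigr => i /negPf ->.
rewrite yE mulrSr in kay; have kk := @atom_compact k.+1.
rewrite mulrSr in kk; have [f [fy fk]] := IHk _ (compact_cancel cancelS kk kay).
exists (fun i => (f i + (i == i0))%N); split=> [i|].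
  rewrite mulrnDr; have := fy i; rewrite /y'; have [->|_] := eqVneq i i0.
    by rewrite yi0 addrC; apply: pom_leD (pom_lexx _).
  by rewrite addr0.
rewrite big_split /= fk (bigD1 i0) //= eqxx big1 ?addn0 ?addn1 //.
by move=> i /negPf ->.
Qed.

(** Below a soft x each compact a *+ n leaves room, which is at least a; so x
    dominates all the multiples of a, and these are cofinal. *)
Lemma soft_top x y : soft x -> x <> 0 -> y <= x.
Proof.
move=> x_soft x_neq0; have x_room := soft_has_room cancelS O5S x_soft x_neq0.
apply: le_way_belowP => y' /way_below_atom[n y'n]; apply: pom_le_trans y'n _.
elim: n => [|n nx]; first exact: pom_ge0.
have [c /atom_le ac ncx] := x_room _ (way_below_le_trans (@atom_compact n) nx).
by rewrite mulrSr; apply: pom_le_trans ncx; apply: pom_leD (pom_lexx _) ac.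
Qed.

Lemma atomic_cu_dim_le n : cu_dim_le S n.
Proof.
move=> x' x r y x'x xy; have [m x'm] := way_below_atom x'x.
have [k x'_ak] := le_atom_mulrn x'm.
have aky : a *+ k <= \sum_j y j.
  by rewrite -x'_ak; apply: pom_le_trans (way_below_le x'x) (way_below_le xy).
have [f [fy fk]] := atom_sum aky.
have fE : \sum_j a *+ f j = x' by rewrite sumrMnr fk.
(* The decomposition of x' is exact, so a single colour is enough. *)
exists (fun j i => if i == ord0 then a *+ f j else 0); split=> [j i||i].
- case: ifP => _; last exact: way_below0.
  exact: way_below_le_trans (@atom_compact _) (fy j).
- rewrite (eq_bigr (fun j => a *+ f j)) => [|j _]; last first.
    by rewrite (bigD1 ord0) //= big1 ?addr0 // => i /negPf ->.
  by rewrite fE x'_ak; apply: atom_compact.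
- by case: (i == ord0); [rewrite fE|rewrite big1 //; apply: way_below0].
Qed.

(** By soft_top, S_soft has at most one nonzero element, and x' ≪ x with x' <> 0
    forces it to be way below itself in S_soft. *)
Lemma atomic_soft_cu_dim_le n : cu_dim_le (softType S) n.
Proof.
have topP (s t : softType S) : s <> 0 -> t <> 0 -> s = t.
  move=> s_neq0 t_neq0; apply: pom_le_anti; apply: soft_top (@softP _ _) _.
  - by move/val_soft_eq0.
  - by move/val_soft_eq0.
move=> x' x r y x'x xy; have [x'0|x'_neq0] := pselect (x' = 0).
  exists (fun _ _ => 0); split=> [j i||i].
  - exact: way_below0.
  - by rewrite x'0; apply: way_below0.
  - by rewrite big1 //; apply: way_below0.
have x_neq0 : x <> 0.
  by move=> x0; apply: x'_neq0; apply: pom_le0; rewrite -x0; apply: way_below_le.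
have [j0 yj0_neq0] : exists j, y j <> 0.
  apply: sum_neq0 => y0; apply: x_neq0; apply: pom_le0.
  by rewrite -y0; apply: way_below_le.
have xx : x ≪ x by rewrite {1}(topP x x').
exists (fun j i => if (j == j0) && (i == ord0) then x else 0); split=> [j i||i].
- by case: ifP => [/andP[/eqP-> _]|_]; [rewrite (topP (y j0) x)|apply: way_below0].
- apply: way_below_le_trans x'x _.
  rewrite (bigD1 j0) //= (bigD1 ord0) //= !eqxx /= -addrA.
  exact: pom_leDl.
- rewrite (bigD1 j0) //= big1 => [|j /negPf->//]; rewrite addr0 eqxx.
  by case: ifP => _; [|apply: way_below0].
Qed.

End Atomic.

(** * Comparison of the dimensions *)

Section Halvable.
Variable S : cuType.
Hypotheses (simpleS : cu_simple S) (cancelS : weakly_cancellative S).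
Hypotheses (O5S : O5 S) (O6S : O6 S) (halvS : halvable S).

(** The z_jk provided by S need not be soft. Adding a nonzero soft w repairs
    this, and w can be chosen so small that z_jk + w ≪ y_j and that the r copies
    of w added in one colour still fit below x. *)
Lemma soft_cu_dim_le n : cu_dim_le S n -> cu_dim_le (softType S) n.
Proof.
move=> dimS x' x r y x'x xy; have [x0|x_neq0] := pselect (x = 0).
  exists (fun _ _ => 0); split=> [j i||i].
  - exact: way_below0.
  - by apply: le_way_below_trans (way_below_le x'x) _; rewrite x0; apply: way_below0.
  - by rewrite big1 //; apply: way_below0.
have room (s : softType S) : s <> 0 -> has_room (val s).
  by move=> s_neq0; apply: soft_has_room (@softP _ s) _ => // /val_soft_eq0.
have nz : exists s : S, s <> 0 by exists (val x) => /val_soft_eq0.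
have toS := soft_way_below simpleS cancelS O5S halvS.
have [|z [zy x'z zx]] := dimS (val x') (val x) r (val \o y) (toS _ _ x'x).
  by rewrite -raddf_sum; apply: toS.
have near_y (p : 'I_r * 'I_n.+1) :
    near0 (fun w => y p.1 <> 0 -> z p.1 p.2 + w ≪ val (y p.1)).
  have [y0|/room y_room] := pselect (y p.1 = 0).
    by case: nz => s s_neq0; exists s => // w _ /(_ y0).
  by have [d d_neq0 dP] := has_room_near0 y_room (zy p.1 p.2); exists d => // w /dP.
have near_x (k : 'I_n.+1) : near0 (fun w => \sum_(j < r) z j k + w *+ r ≪ val x).
  apply: (near0_mulrn halvS (P := fun w => _ + w ≪ _)).
  exact: has_room_near0 (room _ x_neq0) (zx k).
have [w w_room [wy wx]] := near0_has_room halvS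
  (near0_and simpleS O6S (near0_forall simpleS O6S nz near_y)
     (near0_forall simpleS O6S nz near_x)).
(* If y j = 0 there is no room for w, but then z j k = 0 is already soft. *)
pose z' j k := z j k + (if y j == 0 then 0 else w).
have z'y j k : z' j k ≪ val (y j).
  rewrite /z'; have [y0|/eqP y_neq0] := eqVneq (y j) 0; first by rewrite addr0; apply: zy.
  exact: wy (j, k) y_neq0.
have z'_soft j k : soft (z' j k).
  rewrite /z'; have [y0|_] := eqVneq (y j) 0.
    have -> : z j k = 0.
      by apply: pom_le0; have /way_below_le := zy j k; rewrite /= y0.
    by rewrite addr0; apply/asboolP/(soft_pred_addr_closed S).1.
  exact/has_room_soft/has_roomDr.
exists (fun j k => to_soft (z'_soft j k)); split=> [j k||k]; apply: way_below_soft.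
- exact: z'y.
- apply: way_below_le_trans x'z _; rewrite raddf_sum; apply: pom_le_sum => j.
  by rewrite raddf_sum; apply: pom_le_sum => k; apply: pom_leDl.
- apply: le_way_below_trans (wx k); rewrite raddf_sum big_split /=.
  apply: pom_leD (pom_lexx _) _; rewrite -[r in w *+ r]card_ord -sumr_const.
  by apply: pom_le_sum => j; case: ifP => _; [apply: pom_ge0|apply: pom_lexx].
Qed.

(** All errors are paid from u' ≪ u, which contains r.+1 copies of w: r copies
    for the approximations of the y_j by soft s_j, and one that makes the almost
    complement c of u' soft. Then (c + w) + w *+ r <= x ≪ \sum_j s_j + w *+ r, and
    cancelling w *+ r brings c + w into the scope of the dimension of S_soft.
    As x <= u + (c + w), only u has to be covered in addition. *)
Lemma cu_dim_le_soft n : cu_dim_le (softType S) n -> cu_dim_le S n.+1.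
Proof.
move=> dimT x' x r y x'x xy; have [x0|x_neq0] := pselect (x = 0).
  exists (fun _ _ => 0); split=> [j i||i].
  - exact: way_below0.
  - by apply: le_way_below_trans (way_below_le x'x) _; rewrite x0; apply: way_below0.
  - by rewrite big1 //; apply: way_below0.
have [j0 yj0_neq0] : exists j, y j <> 0.
  apply: sum_neq0 => y0; apply: x_neq0; apply: pom_le0.
  by rewrite -y0; apply: way_below_le.
have [u [u_neq0 ux uy]] := common_below simpleS O6S x_neq0 yj0_neq0.
have [u' u'_neq0 u'u] := neq0_way_below u_neq0.
have [c [u'c xc]] := O5_complement O5S u'u ux.
have [w w_room wu'] : exists2 w, has_room w & w *+ r.+1 <= u'.
  apply: (near0_has_room halvS); apply: (near0_mulrn halvS (P := fun w => w <= u')).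
  by exists u'.
have /choice[s sP] j := soft_approx simpleS O5S O6S halvS (y j) (has_room_neq0 w_room).
have s_soft j : soft (s j) by case: (sP j).
have cw_room : has_room (c + w) by apply: has_roomDr.
have cwx : c + w + w *+ r <= x.
  apply: pom_le_trans u'c; rewrite -addrA -mulrS addrC; exact: pom_leD2r.
have cws : c + w ≪ \sum_j s j.
  apply: (cancelS (z := w *+ r)); apply: le_way_below_trans cwx _.
  apply: way_below_le_trans xy _; rewrite -[r in w *+ r]card_ord -sumr_const -big_split.
  by apply: pom_le_sum => j; case: (sP j).
have [u'' [c' [u''u c'cw x'uc]]] :
    exists u'' c', [/\ u'' ≪ u, c' ≪ c + w & x' ≪ u'' + c'].
  apply: way_belowD; apply: way_below_le_trans x'x _; apply: pom_le_trans xc _.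
  by apply: pom_leD (pom_lexx _) (pom_leDl _ _).
have [t [t_room c't tcw]] := has_room_interpolate halvS cw_room c'cw.
pose tT := to_soft (has_room_soft simpleS t_room).
pose cwT := to_soft (has_room_soft simpleS cw_room).
have tcwT : tT ≪ cwT by apply: way_below_soft.
have [|v [vs tv vcw]] := dimT tT cwT r (fun j => to_soft (s_soft j)) tcwT.
  by apply: way_below_soft; rewrite raddf_sum.
have toS := soft_way_below simpleS cancelS O5S halvS.
(* Colour 0 contains only u'', placed at j0; the others are those of v. *)
pose z j k := if unlift ord0 k is Some i then val (v j i)
              else if j == j0 then u'' else 0.
have sum0 : \sum_j (if j == j0 then u'' else 0) = u''.
  by rewrite -big_mkcond big_pred1_eq.
exists z; split=> [j k||k].
- rewrite /z; case: unliftP => [i _|_].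
    by apply: way_below_le_trans (toS _ _ (vs j i)) _; case: (sP j).
  case: eqP => [->|_]; last exact: way_below0.
  exact: way_below_le_trans u''u uy.
- apply: way_below_le_trans x'uc _.
  have -> : \sum_j \sum_k z j k = u'' + val (\sum_j \sum_k v j k).
    rewrite raddf_sum -sum0 -big_split; apply: eq_bigr => j _.
    rewrite raddf_sum big_ord_recl /z unlift_none; congr (_ + _).
    by apply: eq_bigr => i _; rewrite liftK.
  apply: pom_leD (pom_lexx _) _; apply: pom_le_trans c't _.
  exact: way_below_le tv.
- rewrite /z; case: unliftP => [i _|_]; last first.
    by rewrite sum0; apply: way_below_le_trans u''u ux.
  have := toS _ _ (vcw i); rewrite raddf_sum => /way_below_le_trans; apply.
  exact: pom_le_trans (pom_leDl _ _) cwx.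
Qed.

End Halvable.

Lemma cu_dim_le_add (S T : pomType) m :
  (forall n, cu_dim_le T n -> cu_dim_le S (n + m)) ->
  (cu_dim S <= cu_dim T + m%:Z%:E)%E.
Proof.
move=> TS; rewrite /cu_dim.
case: (pselect (exists n, `[< cu_dim_le T n >])) => [exT|_]; last by rewrite addye ?leey.
case: ex_minnP => k /asboolP/TS Sk _.
case: pselect => [exS|[]]; last by exists (k + m)%N; apply/asboolP.
case: ex_minnP => l _ /(_ (k + m)%N) lk.
by rewrite -EFinD lee_fin -PoszD lez_nat; apply/lk/asboolP.
Qed.

Theorem proposition5p9 (S : cuType) :
  cu_simple S -> weakly_cancellative S -> O5 S -> O6 S ->
  (cu_dim (softType S) <= cu_dim S <= cu_dim (softType S) + 1)%E.
Proof.
move=> simpleS cancelS O5S O6S.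
suff [lower upper] : (forall n, cu_dim_le S n -> cu_dim_le (softType S) n) /\
    (forall n, cu_dim_le (softType S) n -> cu_dim_le S n.+1).
  apply/andP; split.
    rewrite -[leRHS]adde0; apply: (@cu_dim_le_add _ _ 0) => n.
    by rewrite addn0; apply: lower.
  by apply: (@cu_dim_le_add _ _ 1) => n; rewrite addn1; apply: upper.
have [[a a_atom]|halvS] := atom_or_halvable simpleS O5S O6S.
  split=> n _; first exact: atomic_soft_cu_dim_le a_atom _.
  exact: atomic_cu_dim_le a_atom _.
by split=> n; [apply: soft_cu_dim_le|apply: cu_dim_le_soft].
Qed.
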